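(* (a) There are exactly two monomial clones on $\mathbb{F}_2$, namely $\langle\{x_1\}\rangle\subset\langle\{x_1x_2\}\rangle$. (b) There are exactly seven monomial clones on $\mathbb{F}_3$, namely the pairwise distinct clones $\langle\{x_1\}\rangle$, $\langle\{x_1^2\}\rangle$, $\langle\{x_1^2x_2^2\}\rangle$, $\langle\{x_1x_2^2\}\rangle$, $\langle\{x_1^2,x_1x_2^2\}\rangle$, $\langle\{x_1x_2x_3\}\rangle$, $\langle\{x_1x_2\}\rangle$, and the covering relations (Hasse diagram) of their inclusion order are exactly $\langle\{x_1\}\rangle\prec\langle\{x_1x_2^2\}\rangle$, $\langle\{x_1x_2^2\}\rangle\prec\langle\{x_1x_2x_3\}\rangle$, $\langle\{x_1x_2x_3\}\rangle\prec\langle\{x_1x_2\}\rangle$, $\langle\{x_1\}\rangle\prec\langle\{x_1^2\}\rangle$, $\langle\{x_1^2\}\rangle\prec\langle\{x_1^2x_2^2\}\rangle$, $\langle\{x_1^2x_2^2\}\rangle\prec\langle\{x_1^2,x_1x_2^2\}\rangle$, $\langle\{x_1x_2^2\}\rangle\prec\langle\{x_1^2,x_1x_2^2\}\rangle$, $\langle\{x_1^2,x_1x_2^2\}\rangle\prec\langle\{x_1x_2\}\rangle$.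
   Context: $\mathbb{N}=\{1,2,\dots\}$, $\mathbb{N}_0=\mathbb{N}\cup\{0\}$; for a prime power $q$, $\mathbb{F}_q$ is the field with $q$ elements. A monomial is a formal product $g=\prod_{i\in\mathbb{N}}x_i^{\alpha(i)}$ with $\alpha(i)\in\mathbb{N}_0$, finitely many but at least one $\alpha(i)$ nonzero (so $1$ is not a monomial); $\mathrm{mI}(g)$ is the largest $i$ with $\alpha(i)\neq0$, called the arity of $g$. For $n\ge\mathrm{mI}(g)$ the $n$-ary induced function is $g^{\mathbb{F}_q^n}\colon\mathbb{F}_q^n\to\mathbb{F}_q$, $(x_1,\dots,x_n)\mapsto\prod_{i=1}^nx_i^{\alpha(i)}$. Monomials $m_1,m_2$ are equivalent if the $\mathrm{mI}(m_1)$-ary induced function of $m_1$ equals the $\mathrm{mI}(m_2)$-ary induced function of $m_2$ (i.e. for each $i$ the exponents of $x_i$ in $m_1$ and $m_2$ are equal, or both positive and congruent modulo $q-1$). A clone on a set $A$ is a set of finitary operations on $A$ (of arities $\ge1$) containing all projections and closed under composition. A set $M$ of monomials is a monomial clone on $\mathbb{F}_q$ if $\{m^{\mathbb{F}_q^n}\mid m\in M,\ n\ge\mathrm{mI}(m)\}$ is a clone on $\mathbb{F}_q$ and $M$ is closed under equivalent monomials. For a set $M'$ of monomials, $\langle M'\rangle$ is the least monomial clone on $\mathbb{F}_q$ containing $M'$ (with $q=2$ in (a), $q=3$ in (b)). Monomial clones are ordered by inclusion; $C\prec D$ means $C\subset D$ (proper inclusion) with no monomial clone strictly between. *)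

(* Defs.v *)
From mathcomp Require Import all_boot all_order all_algebra all_classical.
From mathcomp Require Import finmap monalg.

Set Implicit Arguments.
Unset Strict Implicit.
Unset Printing Implicit Defensive.

Import GRing.Theory.

Local Open Scope classical_set_scope.

(* Index i : nat stands for the variable x_{i+1}, so that the index i of
   {cmonom nat} matches the argument i : 'I_n of an n-ary operation.
   A monomial is an element of {cmonom nat} other than 1. *)
Definition is_monomial (m : {cmonom nat}) : Prop := m <> mone.

Definition x1 : {cmonom nat} := ucm 0.
Definition x2 : {cmonom nat} := ucm 1.
Definition x3 : {cmonom nat} := ucm 2.

Notation "m1 * m2" := (mmul m1 m2) : monom_scope.
Notation "m ^+ k" := (expcmn m k) : monom_scope.

(* Largest k such that x_k occurs in m, with k = i + 1 for the index i. *)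
Definition arity (m : {cmonom nat}) : nat := \max_(i <- finsupp m) i.+1.

Definition operation (A : Type) (n : nat) : Type := ('I_n -> A) -> A.

Record is_clone (A : Type) (C : forall n, set (operation A n)) : Prop :=
  IsClone {
    clone_arity_gt0 : C 0 = set0;
    clone_proj : forall n (i : 'I_n), C n (fun x => x i);
    clone_comp : forall k n (f : operation A k) (g : 'I_k -> operation A n),
      C k f -> (forall i, C n (g i)) -> C n (fun x => f (fun i => g i x))
  }.

(* The n-ary function induced by m; meaningful when arity m <= n. *)
Definition induced (F : finFieldType) (n : nat) (m : {cmonom nat}) :
    operation F n :=
  fun x => (\prod_(i < n) x i ^+ m i)%R.
Arguments induced : clear implicits.

Definition induced_ops (F : finFieldType) (M : set {cmonom nat}) (n : nat) :
    set (operation F n) :=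
  [set induced F n m | m in [set m | M m /\ (arity m <= n)%N]].
Arguments induced_ops : clear implicits.

(* Equality of the arity m1-ary function induced by m1 and the arity m2-ary
   function induced by m2, which have the same domain only if the arities
   agree. *)
Definition equivalent (F : finFieldType) (m1 m2 : {cmonom nat}) : Prop :=
  arity m1 = arity m2 /\
  induced F (arity m1) m1 = induced F (arity m1) m2.

Definition monomial_clone (F : finFieldType) (M : set {cmonom nat}) : Prop :=
  [/\ M `<=` is_monomial,
      is_clone (induced_ops F M) &
      forall m1 m2, M m1 -> is_monomial m2 -> equivalent F m1 m2 -> M m2].

Definition generated (F : finFieldType) (M : set {cmonom nat}) :
    set {cmonom nat} :=
  smallest (monomial_clone F) M.

Definition covered_by (F : finFieldType) (C D : set {cmonom nat}) : Prop :=
  [/\ monomial_clone F C, monomial_clone F D, C `<` D &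
      forall E, monomial_clone F E -> ~ (C `<` E /\ E `<` D)].

(* Main.v *)
Require Import Defs.
From mathcomp Require Import all_boot all_order all_algebra all_classical.
From mathcomp Require Import finmap monalg.
From mathcomp Require Import zify.

(** Over F_2 a monomial is determined up to equivalence by its set of
    variables, over F_3 by its set of variables and the subset of those
    variables whose exponent is odd. A monomial clone is the same thing as a
    set of monomials containing all the variables x_i, closed under the
    substitution of members into a member, and closed under equality of the
    induced power functions (monomial_cloneP). This turns the statement into
    a question about parities and supports of exponents.

    Upper bounds. The following sets have these closure properties over F_3:
    the monomials in one variable; those with exactly one odd exponent; both
    conditions at once; the monomials with all exponents even, together with
    either of the first two sets; the monomials of odd degree; all monomials.
    For each of them, the support and the parities of a composite are read
    off from the supports and the parities of its components.

    Lower bounds. Each of the seven sets is generated by one or two monomials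
    in at most three variables. For instance x_i * n^2 and n^2 are built up
    one variable of n at a time, and a monomial of odd degree two variables
    at a time.

    Classification. Let M be a monomial clone. Renaming x_i to x_1, x_j to
    x_2 and all other variables to x_3 turns a monomial m of degree d in M
    into x_1^(m i) * x_2^(m j) * x_3^(d - m i - m j) in M (contract3), and up
    to equivalence only the parities and the vanishing of these three
    exponents matter. When M is not contained in one of the seven sets, a
    suitable contraction of an offending monomial is x_1^2, x_1 * x_2,
    x_1 * x_2^2, x_1^2 * x_2^2 or x_1 * x_2 * x_3. With the variables, these
    generate all seven sets, so that M is squeezed between one of
    them and its generators (classification3).

    Order. By minimality, one of the seven sets is contained in another iff
    its generators belong to it, which is a computation on exponents; the
    Hasse diagram then follows by running over all pairs. Over F_2 the same
    method leaves only the monomials in one variable and all monomials. *)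

Set Implicit Arguments.
Unset Strict Implicit.
Unset Printing Implicit Defensive.

Import GRing.Theory.

Local Open Scope classical_set_scope.
Local Open Scope monom_scope.

Implicit Types (m : {cmonom nat}) (g : nat -> {cmonom nat}).
Implicit Types (M : set {cmonom nat}).

(** * Exponents, arity and degree *)

Lemma expcmE m k i : (m ^+ k) i = (m i * k)%N.
Proof.
case: k => [|k]; first by rewrite /expcmn cm1 muln0.
elim: k => [|k IHk]; first by rewrite muln1.
by rewrite mulnS -IHk; exact: mulcmE.
Qed.

Lemma arity_leP {m n} :
  reflect (forall i, (n <= i)%N -> m i = 0%N) (arity m <= n)%N.
Proof.
apply: (iffP (bigmax_leqP_seq _ _ _ _)) => [sub_n i le_ni | m0 i i_m _].
  by case: (mdomP m i) => // /sub_n/(_ isT); rewrite ltnNge le_ni.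
by rewrite ltnNge; apply/negP=> /m0/eqP; rewrite cmE_eq0 i_m.
Qed.

Lemma ltn_arity m i : (0 < m i)%N -> (i < arity m)%N.
Proof.
rewrite [(i < _)%N]ltnNge; apply: contraL => le_mi.
by rewrite (arity_leP le_mi).
Qed.

Lemma mdeg_ord m n : (arity m <= n)%N -> mdeg m = (\sum_(i < n) m i)%N.
Proof.
move=> le_mn; rewrite -(big_mkord xpredT (fun i => m i)) mdegE.
rewrite [RHS](bigID (mem (finsupp m))) /= addnC.
rewrite [X in (X + _)%N]big1 ?add0n; last first.
  by move=> i i_m; apply/eqP; rewrite cmE_eq0.
rewrite -[RHS]big_filter; apply: perm_big; apply: uniq_perm.
- exact: fset_uniq.
- exact/filter_uniq/iota_uniq.
move=> i; rewrite mem_filter mem_index_iota /=; case: (mdomP m i) => //= i_m.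
by rewrite (leq_trans _ le_mn) // ltn_arity // lt0n cmE_neq0.
Qed.

Lemma monomialP m : is_monomial m <-> exists i, (0 < m i)%N.
Proof.
split=> [m_neq1 | [i m_i] m1]; last by rewrite m1 cm1 in m_i.
apply: contrapT => /forallNP m0; apply: m_neq1; apply/eqP/cmP=> i.
by rewrite cm1; case: (m i) (m0 i) => // k [].
Qed.

Lemma leq_mdeg2 m i j : i != j -> (m i + m j <= mdeg m)%N.
Proof.
move=> neq_ij; rewrite mdegE.
have [i_m | i_m] := boolP (i \in finsupp m); last first.
  have -> : m i = 0%N by apply/eqP; rewrite cmE_eq0.
  have [j_m | j_m] := boolP (j \in finsupp m).
    by rewrite (big_fsetD1 j) //= leq_addr.
  by have -> : m j = 0%N by apply/eqP; rewrite cmE_eq0.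
rewrite (big_fsetD1 i) //= leq_add2l.
have [j_m | j_m] := boolP (j \in finsupp m).
  by rewrite (big_fsetD1 j) ?leq_addr // !inE eq_sym neq_ij.
by have -> : m j = 0%N by apply/eqP; rewrite cmE_eq0.
Qed.

Lemma monom_ind (P : {cmonom nat} -> Prop) :
  P mone -> (forall i m, P m -> P (ucm i * m)) -> forall m, P m.
Proof.
move=> P1 PU m; have [d] := ubnP (mdeg m); elim: d m => // d IHd m.
have [-> // | /eqP/monomialP[i m_i]] := eqVneq m mone.
have -> : m = ucm i * divcm m (ucm i).
  apply/eqP/cmP=> j; rewrite cmM divcmE cmU.
  by case: eqP => [<- | _]; rewrite ?subn0 // subnKC.
by rewrite mdegM mdegU => lt_d; apply/PU/IHd.
Qed.

(** * Substitution of monomials *)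

Definition subst m g : {cmonom nat} :=
  \big[mmul/mone]_(i < arity m) (g i ^+ m i).

Lemma substE m g n j :
  (arity m <= n)%N -> subst m g j = (\sum_(i < n) g i j * m i)%N.
Proof.
move=> le_mn; rewrite -(big_mkord xpredT (fun i => g i j * m i)%N).
rewrite (big_cat_nat (leq0n _) le_mn) /=.
rewrite [X in (_ + X)%N]big1_seq ?addn0; last first.
  move=> i; rewrite mem_index_iota => /andP[_ /andP[le_i _]].
  by rewrite (arity_leP (leqnn _) _ le_i) muln0.
rewrite big_mkord /subst.
elim/big_rec2: _ => [|i a b _ <-]; first by rewrite cm1.
by rewrite cmM expcmE.
Qed.

Lemma subst_gt0 m g i j : (0 < m i)%N -> (0 < g i j)%N -> (0 < subst m g j)%N.
Proof.
move=> m_i g_ij; rewrite (substE _ _ (leqnn _)).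
rewrite (bigD1 (Ordinal (ltn_arity m_i))) //=.
by rewrite ltn_addr // muln_gt0 g_ij.
Qed.

Lemma arity_subst m g n :
  (forall i, (0 < m i)%N -> (arity (g i) <= n)%N) -> (arity (subst m g) <= n)%N.
Proof.
move=> le_gn; apply/arity_leP=> j le_nj.
rewrite (substE _ _ (leqnn _)) big1 // => i _.
have [-> | m_i] := posnP (m i); first by rewrite muln0.
by rewrite (arity_leP (le_gn i m_i)).
Qed.

(** * Monomial clones as substitution-closed sets of monomials *)

Section MonomialClones.
Variable F : finFieldType.

Definition same_powers m1 m2 : Prop :=
  forall i (x : F), (x ^+ m1 i = x ^+ m2 i)%R.

(** Evaluating at x in position i and 1 elsewhere isolates the power function
    of the variable of index i. *)
Lemma induced_eqP n m1 m2 : (arity m1 <= n)%N -> (arity m2 <= n)%N ->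
  induced F n m1 = induced F n m2 <-> same_powers m1 m2.
Proof.
move=> le1 le2; split=> [eq12 i x | eq12]; last first.
  by apply/funext=> x; apply: eq_bigr.
have [lt_in | le_ni] := ltnP i n; last first.
  by rewrite (arity_leP le1) // (arity_leP le2).
pose e (k : 'I_n) := if k == Ordinal lt_in then x else 1%R.
have ind_e m : induced F n m e = (x ^+ m i)%R.
  rewrite /induced (bigD1 (Ordinal lt_in)) //= big1 ?mulr1 ?/e ?eqxx // => k.
  by move=> /negPf ->; rewrite expr1n.
by rewrite -!ind_e eq12.
Qed.

(** Evaluate at 0, where only the exponent 0 gives a nonzero value. *)
Lemma same_powers_gt0 m1 m2 i :
  same_powers m1 m2 -> (0 < m1 i)%N = (0 < m2 i)%N.
Proof.
move=> /(_ i 0%R); rewrite !expr0n !lt0n.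
by do 2!case: eqP => _ //; move/eqP; rewrite ?oner_eq0 // eq_sym oner_eq0.
Qed.

Lemma same_powers_arity m1 m2 : same_powers m1 m2 -> arity m1 = arity m2.
Proof.
move=> eq12; apply/eqP; rewrite eqn_leq.
apply/andP; split; apply/arity_leP=> i /(arity_leP (leqnn _)) mi0.
all: by have := same_powers_gt0 i eq12; rewrite mi0; case: (_ i).
Qed.

Lemma equivalentP m1 m2 : equivalent F m1 m2 <-> same_powers m1 m2.
Proof.
split=> [[eq_a eq12] | eq12]; first by apply/(induced_eqP _ _ (n := arity m1));
  rewrite // eq_a.
split; first exact: same_powers_arity.
by apply/induced_eqP; rewrite // (same_powers_arity eq12).
Qed.

Lemma induced_ucm n (i : 'I_n) : induced F n (ucm (i : nat)) = fun x => x i.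
Proof.
apply/funext=> x; rewrite /induced (bigD1 i) //= cmUU expr1 big1 ?mulr1 // => j.
by rewrite cmU eq_sym -val_eqE => /negPf ->; rewrite expr0.
Qed.

Lemma arity_ucm i : arity (ucm i) = i.+1.
Proof. by rewrite /arity mdomU big_seq_fset1. Qed.

Lemma induced_subst k n m g : (arity m <= k)%N ->
  (fun x => induced F k m (fun i : 'I_k => induced F n (g i) x))
  = induced F n (subst m g).
Proof.
move=> le_mk; apply/funext=> x; rewrite /induced.
under eq_bigr do rewrite -prodrXl.
rewrite exchange_big; apply: eq_bigr => j _.
rewrite (substE _ _ le_mk) -prodrXr; apply: eq_bigr => i _.
by rewrite exprM.
Qed.

Record subst_closed M : Prop := SubstClosed {
  closed_monomial : M `<=` is_monomial;
  closed_var : forall i, M (ucm i);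
  closed_subst : forall m g, M m -> (forall i, M (g i)) -> M (subst m g);
  closed_same : forall m1 m2, M m1 -> same_powers m1 m2 -> M m2
}.

(** An operation induced by a member of M determines the exponents of that
    member up to same_powers, so that membership in M can be tested on
    induced operations of any large enough arity. With this, projections
    correspond to variables and compositions to substitutions. *)
Lemma monomial_cloneP M : monomial_clone F M <-> subst_closed M.
Proof.
split=> [[M_mon [_ M_proj M_comp] M_eq] | [M_mon M_var M_sub M_eq]].
- have M_same m1 m2 : M m1 -> same_powers m1 m2 -> M m2.
    move=> M1 eq12; apply: M_eq (M1) _ _; last exact/equivalentP.
    have /monomialP[i m1_i] := M_mon _ M1.
    by apply/monomialP; exists i; rewrite -(same_powers_gt0 i eq12).
  have M_ind n m : (arity m <= n)%N -> induced_ops F M n (induced F n m) -> M m.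
    move=> le_mn [m' [M'm le_m'n] eq_mm']; apply: M_same M'm _.
    exact/(induced_eqP le_m'n).
  split=> // [i | m g Mm Mg].
    apply: (M_ind i.+1); first by rewrite arity_ucm.
    by rewrite (induced_ucm (ord_max : 'I_i.+1)); exact: M_proj.
  (* A common arity in which all the substituted monomials can be induced. *)
  pose n := \max_(i < arity m) arity (g i).
  have le_gn (i : 'I_(arity m)) : (arity (g i) <= n)%N.
    exact: leq_bigmax.
  apply: (M_ind n).
    by apply: arity_subst => i /ltn_arity lt_i; exact: (le_gn (Ordinal lt_i)).
  rewrite -(induced_subst _ _ (leqnn _)).
  apply: M_comp => [|i]; first by exists m.
  by exists (g i).
split=> // [|m1 m2 M1 _ /equivalentP]; last exact: M_eq.
split=> [|n i|k n f h [m [Mm le_mk] <-] Ch].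
- apply/seteqP; split=> // f [m [/M_mon/monomialP[i m_i] /arity_leP m0] _].
  by rewrite m0 in m_i.
- by exists (ucm (i : nat)); [split; rewrite ?arity_ucm | exact: induced_ucm].
have /choice[h' h'P] : forall i : 'I_k, exists m', (M m' /\ (arity m' <= n)%N)
    /\ induced F n m' = h i by move=> i; have [m'] := Ch i; exists m'.
(* Indices beyond k do not occur in m; any member of M will do there. *)
pose g i := if insub i is Some j then h' j else ucm 0.
have gE (i : 'I_k) : g i = h' i by rewrite /g valK.
exists (subst m g); last first.
  rewrite -(induced_subst _ _ le_mk); apply/funext=> x; congr induced.
  by apply/funext=> i; rewrite gE; have [_ ->] := h'P i.
split.
  apply: M_sub => // i; rewrite /g; case: insubP => [j _ _ | _] //.
  by have [[]] := h'P j.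
apply: arity_subst => i /ltn_arity lt_i.
have lt_ik := leq_trans lt_i le_mk.
by have /= -> := gE (Ordinal lt_ik); have [[]] := h'P (Ordinal lt_ik).
Qed.

Lemma generatedE (A : set {cmonom nat}) C : subst_closed C -> A `<=` C ->
  (forall M, subst_closed M -> A `<=` M -> C `<=` M) -> generated F A = C.
Proof.
move=> /monomial_cloneP C_clone A_C C_min; apply/seteqP; split.
  exact: smallest_sub.
by move=> m Cm M [/monomial_cloneP M_clone A_M]; exact: C_min Cm.
Qed.

Definition mon3 a b c : {cmonom nat} := x1 ^+ a * x2 ^+ b * x3 ^+ c.

Lemma mon3E a b c i : mon3 a b c i = nth 0%N [:: a; b; c] i.
Proof.
rewrite /mon3 !cmM !expcmE !cmU.
by case: i => [|[|[|i]]]; rewrite ?mul1n ?mul0n ?addn0 /= ?nth_nil.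
Qed.

Lemma arity_mon3 a b c : (arity (mon3 a b c) <= 3)%N.
Proof. by apply/arity_leP=> i le3i; rewrite mon3E nth_default. Qed.

Section Closed.
Variable M : set {cmonom nat}.
Hypothesis M_closed : subst_closed M.

Let M_var i : M (ucm i). Proof. exact: (closed_var M_closed). Qed.

Lemma closed_mon3 a b c m1 m2 m3 :
  M (mon3 a b c) -> M m1 -> M m2 -> M m3 -> M (m1 ^+ a * m2 ^+ b * m3 ^+ c).
Proof.
move=> Mabc M1 M2 M3.
have -> : m1 ^+ a * m2 ^+ b * m3 ^+ c
    = subst (mon3 a b c) (nth (ucm 0) [:: m1; m2; m3]).
  apply/eqP/cmP=> j; rewrite !cmM !expcmE (substE _ _ (arity_mon3 a b c)).
  by rewrite 3!big_ord_recl big_ord0 !mon3E /= addn0 addnA.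
apply: (closed_subst M_closed) => // i.
by case: i => [|[|[|i]]] //=; rewrite nth_nil; exact: closed_var.
Qed.

(** Rename x_i to x1, x_j to x2 and the remaining variables to x3. Such
    identifications leave only finitely many kinds of exponents to consider. *)
Lemma contract3 m i j : i != j -> M m ->
  M (mon3 (m i) (m j) (mdeg m - (m i + m j))).
Proof.
move=> neq_ij Mm; pose f k := if k == i then 0 else if k == j then 1 else 2.
suff -> : mon3 (m i) (m j) (mdeg m - (m i + m j))
    = subst m (fun k => ucm (f k)).
  by apply: (closed_subst M_closed) => // k; exact: closed_var.
pose n := maxn (arity m) (maxn i.+1 j.+1).
have [lt_in lt_jn] : (i < n)%N /\ (j < n)%N by rewrite !leq_max !leqnn !orbT.
have le_mn : (arity m <= n)%N by rewrite leq_maxl.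
pose oi := Ordinal lt_in; pose oj := Ordinal lt_jn.
have neq_ji : oj != oi by rewrite -val_eqE eq_sym.
pose s := (\sum_(k < n | (k != oi) && (k != oj)) m k)%N.
have -> : (mdeg m - (m i + m j) = s)%N.
  rewrite (mdeg_ord le_mn) (bigD1 oi) //= (bigD1 oj) //= addnA.
  by rewrite addKn.
apply/eqP/cmP=> l; rewrite (substE _ _ le_mn) mon3E.
rewrite (bigD1 oi) //= (bigD1 oj) //= !cmU.
rewrite (eq_bigr (fun k : 'I_n => (2 == l) * m k)%N); last first.
  move=> k /andP[/negPf ki /negPf kj]; rewrite cmU /f.
  by rewrite -!val_eqE in ki kj; rewrite ki kj.
rewrite -big_distrr /= -/s /f !eqxx [j == i]eq_sym (negPf neq_ij).
by case: l => [|[|[|l]]]; rewrite /= ?mul1n ?mul0n ?addn0 ?nth_nil.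
Qed.

Lemma contract2 m i : M m -> M (mon3 (m i) (mdeg m - m i) 0).
Proof.
move=> Mm; have neq_i : i != i.+1 by rewrite neq_ltn leqnn.
have := contract3 neq_i Mm => /closed_mon3.
move=> /(_ (ucm 0) (ucm 1) (ucm 1)).
move=> /(_ (M_var _) (M_var _) (M_var _)).
congr M; apply/eqP/cmP=> j; rewrite mon3E !cmM !expcmE !cmU.
have := leq_mdeg2 m neq_i.
case: j => [|[|[|j]]]; rewrite /= ?nth_nil; lia.
Qed.

Lemma contract1 m : M m -> M (mon3 (mdeg m) 0 0).
Proof.
move=> Mm; have := contract2 0 Mm => /closed_mon3.
move=> /(_ (ucm 0) (ucm 0) (ucm 0)).
move=> /(_ (M_var _) (M_var _) (M_var _)).
congr M; apply/eqP/cmP=> j; rewrite mon3E !cmM !expcmE !cmU.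
have := @leq_mdeg2 m 0 1 isT.
case: j => [|[|[|j]]]; rewrite /= ?nth_nil; lia.
Qed.

Lemma closed_mul m1 m2 : M (mon3 1 1 0) -> M m1 -> M m2 -> M (m1 * m2).
Proof.
by move=> M110 M1 M2; have := closed_mon3 M110 M1 M2 M2; rewrite mulm1.
Qed.

Lemma monomials_min : M (mon3 1 1 0) -> is_monomial `<=` M.
Proof.
move=> M110 m; elim/monom_ind: m => [[] // | i m IHm _].
have [-> | /eqP m_neq1] := eqVneq m mone.
  by rewrite mulm1.
exact: (closed_mul M110 (M_var i) (IHm m_neq1)).
Qed.

End Closed.
End MonomialClones.

(** * Supports and parities of composites *)

Lemma odd_sum n (f : 'I_n -> nat) :
  odd (\sum_(i < n) f i) = \big[addb/false]_(i < n) odd (f i).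
Proof. exact: (big_morph odd oddD). Qed.

Definition one_var : set {cmonom nat} :=
  [set m | exists i, forall j, (0 < m j)%N = (j == i)].
Definition one_odd : set {cmonom nat} :=
  [set m | exists i, forall j, odd (m j) = (j == i)].
Definition all_even : set {cmonom nat} :=
  [set m | is_monomial m /\ forall j, ~~ odd (m j)].
Definition odd_deg : set {cmonom nat} := [set m | odd (mdeg m)].

Lemma one_odd_deg : one_odd `<=` odd_deg.
Proof.
move=> m [i m_i].
have lt_i : (i < arity m)%N by rewrite ltn_arity // odd_gt0 ?m_i.
rewrite /odd_deg /= (mdeg_ord (leqnn _)) odd_sum (bigD1 (Ordinal lt_i)) //=.
rewrite m_i eqxx big1 // => k; rewrite -val_eqE /= m_i; exact: negbTE.
Qed.

Lemma all_even_deg m : all_even m -> ~~ odd (mdeg m).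
Proof.
move=> [_ m_even]; rewrite (mdeg_ord (leqnn _)) odd_sum big1 // => i _.
exact: negbTE.
Qed.

Lemma other_index (p : nat -> bool) i :
  ~ (exists k, forall j, p j = (j == k)) -> p i -> exists2 j, i != j & p j.
Proof.
move=> p_many p_i; apply: contrapT => no_j; apply: p_many; exists i => j.
case: eqP => [-> // | /nesym/eqP neq_ij]; apply/negP=> p_j.
by apply: no_j; exists j.
Qed.

Lemma subst_one_var m g i j :
  (forall k, (0 < m k)%N = (k == i)) -> subst m g j = (g i j * m i)%N.
Proof.
move=> m_i; have lt_i : (i < arity m)%N by rewrite ltn_arity // m_i.
rewrite (substE _ _ (leqnn _)) (bigD1 (Ordinal lt_i)) //= big1 ?addn0 // => k.
by rewrite -val_eqE /= -m_i lt0n negbK => /eqP ->; rewrite muln0.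
Qed.

Lemma odd_subst m g j :
  odd (subst m g j) = \big[addb/false]_(i < arity m) (odd (g i j) && odd (m i)).
Proof.
by rewrite (substE _ _ (leqnn _)) odd_sum; apply: eq_bigr => i _; rewrite oddM.
Qed.

Lemma odd_subst_one_odd m g i j :
  (forall k, odd (m k) = (k == i)) -> odd (subst m g j) = odd (g i j).
Proof.
move=> m_i; have lt_i : (i < arity m)%N by rewrite ltn_arity // odd_gt0 ?m_i.
rewrite odd_subst (bigD1 (Ordinal lt_i)) //= m_i eqxx andbT big1 ?addbF // => k.
by rewrite -val_eqE /= m_i => /negPf ->; rewrite andbF.
Qed.

Lemma odd_subst_all_even m g j :
  (forall k, ~~ odd (m k)) -> ~~ odd (subst m g j).
Proof.
move=> m_even; rewrite odd_subst big1 // => k _.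
by rewrite (negPf (m_even k)) andbF.
Qed.

Lemma mdeg_subst m g :
  mdeg (subst m g) = (\sum_(i < arity m) mdeg (g i) * m i)%N.
Proof.
rewrite mdeg_prod; apply: eq_bigr => i _.
elim: (m i) => [|k IHk]; first by rewrite mdeg1 muln0.
rewrite mulnSr -IHk -mdegM; congr mdeg; apply/eqP/cmP=> j.
by rewrite cmM !expcmE mulnSr.
Qed.

Lemma odd_mdeg_subst m g :
  (forall i, odd (mdeg (g i))) -> odd (mdeg (subst m g)) = odd (mdeg m).
Proof.
move=> g_odd; rewrite mdeg_subst (mdeg_ord (leqnn _)) !odd_sum.
by apply: eq_bigr => i _; rewrite oddM g_odd.
Qed.

Lemma subst_monomial m g : is_monomial m -> (forall i, is_monomial (g i)) ->
  is_monomial (subst m g).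
Proof.
move=> /monomialP[i m_i] /(_ i)/monomialP[j g_ij].
by apply/monomialP; exists j; exact: subst_gt0 g_ij.
Qed.

Lemma ucm_monomial i : is_monomial (ucm i).
Proof. by apply/monomialP; exists i; rewrite cmUU. Qed.

Lemma one_var_monomial : one_var `<=` is_monomial.
Proof. by move=> m [i m_i]; apply/monomialP; exists i; rewrite m_i. Qed.

Lemma one_odd_monomial : one_odd `<=` is_monomial.
Proof.
by move=> m [i m_i]; apply/monomialP; exists i; rewrite odd_gt0 ?m_i.
Qed.

Lemma one_var_ucm i : one_var (ucm i).
Proof. by exists i => j; rewrite cmU eq_sym; case: eqP. Qed.

Lemma one_odd_ucm i : one_odd (ucm i).
Proof. by exists i => j; rewrite cmU eq_sym; case: eqP. Qed.

Lemma one_var_subst m g : one_var m -> (forall i, one_var (g i)) ->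
  one_var (subst m g).
Proof.
move=> [i m_i] /(_ i)[k g_k]; exists k => j.
by rewrite (subst_one_var _ _ m_i) muln_gt0 m_i eqxx andbT.
Qed.

Lemma one_odd_subst m g : one_odd m -> (forall i, one_odd (g i)) ->
  one_odd (subst m g).
Proof.
move=> [i m_i] /(_ i)[k g_k]; exists k => j.
by rewrite (odd_subst_one_odd _ _ m_i).
Qed.

(** * The closed sets *)

Section AnyField.
Variable F : finFieldType.

Lemma same_powers_monomial m1 m2 :
  is_monomial m1 -> same_powers F m1 m2 -> is_monomial m2.
Proof.
move=> /monomialP[i m1_i] eq12; apply/monomialP; exists i.
by rewrite -(same_powers_gt0 i eq12).
Qed.

Lemma same_powers_one_var m1 m2 :
  one_var m1 -> same_powers F m1 m2 -> one_var m2.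
Proof.
by move=> [i m1_i] eq12; exists i => j; rewrite -(same_powers_gt0 j eq12).
Qed.

Lemma monomials_closed : subst_closed F is_monomial.
Proof.
split=> //; [exact: ucm_monomial | exact: subst_monomial |].
exact: same_powers_monomial.
Qed.

Lemma one_var_closed : subst_closed F one_var.
Proof.
split; [exact: one_var_monomial | exact: one_var_ucm | exact: one_var_subst |].
exact: same_powers_one_var.
Qed.

End AnyField.

Lemma same_powers_F2 m1 m2 :
  same_powers 'F_2 m1 m2 <-> forall i, (0 < m1 i)%N = (0 < m2 i)%N.
Proof.
split=> [eq12 i | eq12 i x]; first exact: same_powers_gt0 eq12.
have /orP[]: (x == 0%R) || (x == 1%R) by case: x => [[|[|]]].
  by move/eqP->; move: (eq12 i); rewrite !expr0n !lt0n; do 2!case: eqP.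
by move/eqP->; rewrite !expr1n.
Qed.

(** The elements of F_3 are 0, which detects the vanishing of an exponent,
    and 1 and -1, which together detect its parity. *)
Lemma same_powers_F3 m1 m2 : same_powers 'F_3 m1 m2 <->
  forall i, (0 < m1 i)%N = (0 < m2 i)%N /\ odd (m1 i) = odd (m2 i).
Proof.
split=> [eq12 i | eq12 i x].
  split; first exact: same_powers_gt0 eq12.
  have := eq12 i (-1)%R; rewrite -signr_odd -[RHS]signr_odd.
  by do 2!case: odd.
have [eq_gt0 eq_odd] := eq12 i.
have /or3P[]: [|| x == 0%R, x == 1%R | x == (-1)%R].
  by case: x => [[|[|[|]]]].
- by move/eqP->; move: eq_gt0; rewrite !expr0n !lt0n; do 2!case: eqP.
- by move/eqP->; rewrite !expr1n.
- by move/eqP->; rewrite -signr_odd eq_odd signr_odd.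
Qed.

Lemma same_powers_odd m1 m2 i :
  same_powers 'F_3 m1 m2 -> odd (m1 i) = odd (m2 i).
Proof. by move=> /same_powers_F3/(_ i)[]. Qed.

Lemma same_powers_one_odd m1 m2 :
  one_odd m1 -> same_powers 'F_3 m1 m2 -> one_odd m2.
Proof.
by move=> [i m1_i] eq12; exists i => j; rewrite -(same_powers_odd j eq12).
Qed.

Lemma same_powers_all_even m1 m2 :
  all_even m1 -> same_powers 'F_3 m1 m2 -> all_even m2.
Proof.
move=> [m1_neq1 m1_even] eq12; split; first exact: same_powers_monomial eq12.
by move=> j; rewrite -(same_powers_odd j eq12).
Qed.

Lemma same_powers_odd_deg m1 m2 :
  odd_deg m1 -> same_powers 'F_3 m1 m2 -> odd_deg m2.
Proof.
move=> + eq12; rewrite /odd_deg /= (mdeg_ord (leqnn _)).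
rewrite (mdeg_ord (leqnn (arity m2))) -(same_powers_arity eq12) !odd_sum.
by under eq_bigr do rewrite (same_powers_odd _ eq12).
Qed.

Lemma one_odd_closed : subst_closed 'F_3 one_odd.
Proof.
split; [exact: one_odd_monomial | exact: one_odd_ucm | exact: one_odd_subst |].
exact: same_powers_one_odd.
Qed.

Lemma variables_closed : subst_closed 'F_3 (one_var `&` one_odd).
Proof.
split=> [m [+ _] | i | m g [m1 m2] g12 | m1 m2 [a b] eq12].
- exact: one_var_monomial.
- by split; [exact: one_var_ucm | exact: one_odd_ucm].
- by split; [apply: one_var_subst m1 _ | apply: one_odd_subst m2 _] => i;
    case: (g12 i).
- split; first exact: same_powers_one_var eq12.
  exact: same_powers_one_odd eq12.
Qed.

Lemma all_even_subst m g : all_even m -> (forall i, is_monomial (g i)) ->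
  all_even (subst m g).
Proof.
move=> [m_neq1 m_even] g_neq1; split; first exact: subst_monomial.
by move=> j; exact: odd_subst_all_even.
Qed.

Lemma all_even_one_var_closed : subst_closed 'F_3 (all_even `|` one_var).
Proof.
have mon : all_even `|` one_var `<=` is_monomial.
  by move=> m [[] // | /one_var_monomial].
split=> // [i | m g [m_even | [i m_i]] mg | m1 m2 [m1P | m1P] eq12].
- by right; exact: one_var_ucm.
- by left; apply: all_even_subst => // i; exact: mon.
- have [[g_neq1 g_even] | [k g_k]] := mg i.
    left; split=> [|j]; last first.
      by rewrite (subst_one_var _ _ m_i) oddM negb_and g_even.
    apply: subst_monomial; first by apply: one_var_monomial; exists i.
    by move=> k; exact: mon.
  right; exists k => j.
  by rewrite (subst_one_var _ _ m_i) muln_gt0 m_i eqxx andbT.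
- by left; exact: same_powers_all_even eq12.
- by right; exact: same_powers_one_var eq12.
Qed.

(** A composite m(g) has the parities of g i when i is the only index with an
    odd exponent in m, and all exponents even when there is no such index. *)
Lemma all_even_one_odd_closed : subst_closed 'F_3 (all_even `|` one_odd).
Proof.
have mon : all_even `|` one_odd `<=` is_monomial.
  by move=> m [[] // | /one_odd_monomial].
split=> // [i | m g [m_even | [i m_i]] mg | m1 m2 [m1P | m1P] eq12].
- by right; exact: one_odd_ucm.
- by left; apply: all_even_subst => // i; exact: mon.
- have [[g_neq1 g_even] | [k g_k]] := mg i.
    left; split=> [|j]; last by rewrite (odd_subst_one_odd _ _ m_i).
    apply: subst_monomial; first by apply: one_odd_monomial; exists i.
    by move=> k; exact: mon.
  by right; exists k => j; rewrite (odd_subst_one_odd _ _ m_i).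
- by left; exact: same_powers_all_even eq12.
- by right; exact: same_powers_one_odd eq12.
Qed.

Lemma odd_deg_closed : subst_closed 'F_3 odd_deg.
Proof.
split=> [m m_odd m1 | i | m g m_odd g_odd | m1 m2].
- by move: m_odd; rewrite /odd_deg /= m1 mdeg1.
- by rewrite /odd_deg /= mdegU.
- by rewrite /odd_deg /= odd_mdeg_subst.
- exact: same_powers_odd_deg.
Qed.

(** * Generating the closed sets over F_3 *)

Section Generation.
Variable M : set {cmonom nat}.
Hypothesis M_closed : subst_closed 'F_3 M.

Let M_var i : M (ucm i). Proof. exact: closed_var M_closed _. Qed.

Lemma closed_same3 m1 m2 : M m1 ->
  (forall i, (0 < m1 i)%N = (0 < m2 i)%N /\ odd (m1 i) = odd (m2 i)) -> M m2.
Proof.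
by move=> M1 eq12; apply: (closed_same M_closed) M1 _; apply/same_powers_F3.
Qed.

Lemma variables_min : one_var `&` one_odd `<=` M.
Proof.
move=> m [[i m_i] [k m_k]]; apply: closed_same3 (M_var i) _ => j.
have <- : k = i by apply/eqP; rewrite -m_i odd_gt0 ?m_k.
rewrite m_k cmU eq_sym m_i.
have -> : k = i by apply/eqP; rewrite -m_i odd_gt0 ?m_k.
by case: eqP.
Qed.

(** A positive power of x_i is equivalent to x_i or to its square. *)
Lemma one_var_min : M (mon3 2 0 0) -> one_var `<=` M.
Proof.
move=> M200 m [i m_i].
have [m_odd | m_even] := boolP (odd (m i)).
  apply: variables_min; split; first by exists i.
  exists i => j; case: eqP => [-> // | /eqP neq_ji].
  by have := m_i j; rewrite (negPf neq_ji); case: (m j).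
have M_sq := closed_mon3 M_closed M200 (M_var i) (M_var i) (M_var i).
apply: closed_same3 M_sq _ => j.
rewrite !cmM !expcmE !muln0 !addn0 cmU m_i [j == i]eq_sym.
have := m_i j; case: (eqVneq i j) => [<- _ | _]; last by case: (m j).
by rewrite (negPf m_even).
Qed.

(** Induction on the variables of m, two at a time: the product of x_i, x_j
    and a member is a member. The second conjunct of the strengthened claim
    covers the degrees between two such steps. *)
Lemma odd_deg_min : M (mon3 1 1 1) -> odd_deg `<=` M.
Proof.
move=> M111 m.
suff: (odd (mdeg m) -> M m) /\ (forall i, ~~ odd (mdeg m) -> M (ucm i * m)).
  by case.
elim/monom_ind: m => [|j m [IHodd IHeven]]; rewrite ?mdeg1 ?mdegM ?mdegU /=.
  by split=> // i _; rewrite mulm1.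
split=> [|i]; first exact: IHeven.
rewrite negbK => /IHodd Mm; rewrite mulmA.
exact: (closed_mon3 M_closed M111 (M_var i) (M_var j) Mm).
Qed.

(** Every m with one odd exponent is x_i * n^2, where n has the halved
    exponents, and (x_i * n^2) * x_j^2 = x_i * (n * x_j)^2. *)
Lemma one_odd_min : M (mon3 1 2 0) -> one_odd `<=` M.
Proof.
move=> M120 m [i m_i].
have M_sq n : M (ucm i * n ^+ 2).
  elim/monom_ind: n => [|j n IHn].
    apply: closed_same3 (M_var i) _ => j.
    by rewrite cmM expcmE cm1 mul0n addn0.
  have Mjn := closed_mon3 M_closed M120 IHn (M_var j) (M_var j).
  apply: closed_same3 Mjn _ => k.
  rewrite !cmM !expcmE ?cmM ?expcmE; split; lia.
have := M_sq [cmonom (m k)./2 | k in finsupp m].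
congr M; apply/eqP/cmP=> j.
rewrite cmM expcmE cmU cmE fsfun_fun muln2 eq_sym -m_i.
by case: (mdomP m j) => // _; rewrite odd_double_half.
Qed.

(** Every m with even exponents is n^2, and up to equivalence
    x_j^2 * (n^2)^2 is (x_j * n)^2. *)
Lemma all_even_min : M (mon3 2 2 0) -> all_even `<=` M.
Proof.
move=> M220 m [m_neq1 m_even].
have M_sq n : n = mone \/ M (n ^+ 2).
  elim/monom_ind: n => [|j n IHn]; first by left.
  right; case: IHn => [-> | Mn].
    have Mj := closed_mon3 M_closed M220 (M_var j) (M_var j) (M_var j).
    apply: closed_same3 Mj _ => k.
    by rewrite !cmM !expcmE ?cmM; split; lia.
  apply: closed_same3 (closed_mon3 M_closed M220 (M_var j) Mn Mn) _ => k.
  by rewrite !cmM !expcmE ?cmM ?expcmE; split; lia.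
have mE : [cmonom (m k)./2 | k in finsupp m] ^+ 2 = m.
  apply/eqP/cmP=> j; rewrite expcmE cmE fsfun_fun muln2.
  case: (mdomP m j) => // _.
  by rewrite -[RHS]odd_double_half (negPf (m_even j)).
case: (M_sq [cmonom (m k)./2 | k in finsupp m]) => [m1 | ]; last by rewrite mE.
by case: m_neq1; rewrite -mE m1; apply/eqP/cmP=> j; rewrite expcmE cm1.
Qed.

(** Equality of the power functions of a and b on F_3. *)
Definition sim3 a b := (odd a == odd b) && ((0 < a)%N == (0 < b)%N).

Lemma closed_sim3 a b c a' b' c' : M (mon3 a b c) ->
  sim3 a a' -> sim3 b b' -> sim3 c c' -> M (mon3 a' b' c').
Proof.
move=> Mabc /andP[/eqP oa /eqP za] /andP[/eqP ob /eqP zb].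
move=> /andP[/eqP oc /eqP zc].
by apply: closed_same3 Mabc _ => -[|[|[|i]]]; rewrite !mon3E /= ?nth_nil.
Qed.

(** In this lemma and the next four the generator is a contraction of m: to one
    variable, to a chosen variable and all others, or to two chosen
    variables and the rest. The degree of m gives the parity of the last
    exponent. *)
Lemma square_mem m : M m -> ~~ odd (mdeg m) -> M (mon3 2 0 0).
Proof.
move=> Mm m_even; have /eqP := closed_monomial M_closed Mm.
rewrite -mdeg_eq0 => m_gt0.
apply: closed_sim3 (contract1 M_closed Mm) _ _ _ => //.
by rewrite /sim3 (negPf m_even) lt0n m_gt0.
Qed.

Lemma product2_mem m i :
  M m -> odd (m i) -> ~~ odd (mdeg m) -> M (mon3 1 1 0).
Proof.
move=> Mm m_i m_even; have le_mi : (m i <= mdeg m)%N.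
  by have := @leq_mdeg2 m i i.+1; lia.
by apply: closed_sim3 (contract2 M_closed i Mm) _ _ _; rewrite // /sim3; lia.
Qed.

Lemma product3_mem m i j : M m -> i != j -> odd (m i) -> odd (m j) ->
  odd (mdeg m) -> M (mon3 1 1 1).
Proof.
move=> Mm neq_ij m_i m_j m_odd; have le_m := leq_mdeg2 m neq_ij.
apply: closed_sim3 (contract3 M_closed neq_ij Mm) _ _ _; rewrite // /sim3.
all: lia.
Qed.

Lemma var_square_mem m : M m -> one_odd m -> ~ one_var m -> M (mon3 1 2 0).
Proof.
move=> Mm m_one m_nvar; have m_deg := one_odd_deg m_one.
have [i m_i] := m_one; have m_oi : odd (m i) by rewrite m_i.
have [j neq_ij m_j] := other_index m_nvar (odd_gt0 m_oi).
have le_m := leq_mdeg2 m neq_ij; rewrite /odd_deg /= in m_deg.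
by apply: closed_sim3 (contract2 M_closed i Mm) _ _ _; rewrite // /sim3; lia.
Qed.

Lemma square_square_mem m :
  M m -> all_even m -> ~ one_var m -> M (mon3 2 2 0).
Proof.
move=> Mm m_ev m_nvar; have m_deg := all_even_deg m_ev.
have /monomialP[i m_i] := closed_monomial M_closed Mm; have m_ei := m_ev.2 i.
have [j neq_ij m_j] := other_index m_nvar m_i.
have le_m := leq_mdeg2 m neq_ij.
by apply: closed_sim3 (contract2 M_closed i Mm) _ _ _; rewrite // /sim3; lia.
Qed.

Lemma square_of_square_square : M (mon3 2 2 0) -> M (mon3 2 0 0).
Proof.
by move=> M220; apply: (square_mem M220); rewrite !mdegM !mdegU mdeg1.
Qed.

(** Substituting x1 * x2^2 into x1^2 gives x1^2 * x2^4, which induces the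
    same function as x1^2 * x2^2. *)
Lemma square_square_of_var_square :
  M (mon3 2 0 0) -> M (mon3 1 2 0) -> M (mon3 2 2 0).
Proof.
move=> M200 M120.
apply: closed_same3 (closed_mon3 M_closed M200 M120 M120 M120) _ => // j.
by rewrite !cmM !expcmE ?cmM ?expcmE !cmU; split; lia.
Qed.

(** Squaring the third factor of x1 * x2 * x3 yields x1 * x2 * x3^2, whose
    degree is even although x1 has an odd exponent. *)
Lemma product2_of_product3_square :
  M (mon3 1 1 1) -> M (mon3 2 0 0) -> M (mon3 1 1 0).
Proof.
move=> M111 M200.
have := closed_mon3 M_closed M200 (M_var 2) (M_var 2) (M_var 2).
move=> /(closed_mon3 M_closed M111 (M_var 0) (M_var 1)) Mx.
apply: (product2_mem (i := 0) Mx); first by rewrite !cmM !expcmE !cmU.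
by rewrite !mdegM !mdegU mdeg1.
Qed.

End Generation.

(** * The seven clones over F_3 *)

(** Generators are kept as triples of exponents of x1, x2, x3, so that their
    membership in the seven sets can be decided by computation. *)
Definition generators3 : seq (seq (nat * nat * nat)) :=
  [:: [:: (1, 0, 0)]; [:: (2, 0, 0)]; [:: (2, 2, 0)]; [:: (1, 2, 0)];
      [:: (2, 0, 0); (1, 2, 0)]; [:: (1, 1, 1)]; [:: (1, 1, 0)]].

(** Each set is generated by the entry of generators3 at the same position. *)
Definition clones3 : seq (set {cmonom nat}) :=
  [:: one_var `&` one_odd; one_var; all_even `|` one_var; one_odd;
      all_even `|` one_odd; odd_deg; is_monomial].

Definition mon3t (t : nat * nat * nat) := mon3 t.1.1 t.1.2 t.2.
Definition gen_set k : set {cmonom nat} :=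
  [set m | exists2 t, t \in nth [::] generators3 k & m = mon3t t].
Notation clone3 k := (nth set0 clones3 k).

(** In each of the seven sets membership depends only on the number of
    variables and the number of odd exponents, which has the parity of the
    degree. *)
Definition in_clone3 k (t : nat * nat * nat) : bool :=
  let: (a, b, c) := t in
  let nvar := ((0 < a) + (0 < b) + (0 < c))%N in
  let nodd := (odd a + odd b + odd c)%N in
  nth false
    [:: (nvar == 1) && (nodd == 1); nvar == 1;
        (0 < nvar) && (nodd == 0) || (nvar == 1); nodd == 1;
        (0 < nvar) && (nodd == 0) || (nodd == 1); odd nodd; 0 < nvar] k.

Lemma unique3P (p : nat -> bool) : (forall i, p i.+3 = false) ->
  (exists i, forall j, p j = (j == i)) <-> p 0 + p 1 + p 2 == 1.
Proof.
move=> p3; split=> [[i p_i] | ].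
  case: i p_i => [|[|[|i]]] p_i; rewrite ?p_i //.
  by have := p3 i; rewrite p_i eqxx.
case p0: (p 0); case p1: (p 1); case p2: (p 2) => // _;
  [exists 0 | exists 1 | exists 2]; by case=> [|[|[|j]]].
Qed.

Lemma one_var_mon3 a b c : one_var (mon3 a b c) <->
  ((0 < a) + (0 < b) + (0 < c) == 1)%N.
Proof.
have := @unique3P (fun i => 0 < mon3 a b c i)%N; rewrite !mon3E; apply.
by move=> i; rewrite mon3E nth_default.
Qed.

Lemma one_odd_mon3 a b c : one_odd (mon3 a b c) <->
  (odd a + odd b + odd c == 1)%N.
Proof.
have := @unique3P (fun i => odd (mon3 a b c i)); rewrite !mon3E; apply.
by move=> i; rewrite mon3E nth_default.
Qed.

Lemma monomial_mon3 a b c : is_monomial (mon3 a b c) <->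
  (0 < (0 < a) + (0 < b) + (0 < c))%N.
Proof.
split=> [/monomialP[] | abc_gt0].
  by move=> [|[|[|i]]]; rewrite mon3E /= ?nth_nil // => ->;
    rewrite ?addn1 ?addnS.
apply/monomialP; have [a0 | a_gt0] := posnP a.
  have [b0 | b_gt0] := posnP b.
    exists 2; rewrite mon3E; move: abc_gt0; rewrite a0 b0 /=.
    by case: (c).
  by exists 1; rewrite mon3E.
by exists 0; rewrite mon3E.
Qed.

Lemma all_even_mon3 a b c : all_even (mon3 a b c) <->
  (0 < (0 < a) + (0 < b) + (0 < c))%N && (odd a + odd b + odd c == 0)%N.
Proof.
split=> [[/monomial_mon3 -> abc_even] | /andP[abc_gt0 abc_even]].
  have := abc_even 0; have := abc_even 1; have := abc_even 2; rewrite !mon3E /=.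
  by do 3!case: odd.
split=> [|j]; first exact/monomial_mon3.
move: abc_even; rewrite !addn_eq0 !eqb0 mon3E => /andP[/andP[oa ob] oc].
by case: j => [|[|[|j]]]; rewrite /= ?nth_nil.
Qed.

Lemma mdeg_mon3 a b c : mdeg (mon3 a b c) = (a + b + c)%N.
Proof.
rewrite (mdeg_ord (arity_mon3 a b c)) !big_ord_recl big_ord0 !mon3E /=.
by rewrite addn0 addnA.
Qed.

Lemma in_clone3P k t : (k < 7)%N -> clone3 k (mon3t t) <-> in_clone3 k t.
Proof.
case: t => [[a b] c].
move: k => [|[|[|[|[|[|[|]]]]]]] // _; rewrite /mon3t /in_clone3.
- split=> [[/one_var_mon3 -> /one_odd_mon3 ->] // | /andP[]].
  by split; [exact/one_var_mon3 | exact/one_odd_mon3].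
- exact: one_var_mon3.
- split=> [[/all_even_mon3 -> | /one_var_mon3 ->] | /orP[]]; rewrite ?orbT //.
    by left; exact/all_even_mon3.
  by right; exact/one_var_mon3.
- exact: one_odd_mon3.
- split=> [[/all_even_mon3 -> | /one_odd_mon3 ->] | /orP[]]; rewrite ?orbT //.
    by left; exact/all_even_mon3.
  by right; exact/one_odd_mon3.
- by rewrite /= /odd_deg /= mdeg_mon3 !oddD !oddb.
- exact: monomial_mon3.
Qed.

Lemma gen_setP k M : gen_set k `<=` M <->
  forall t, t \in nth [::] generators3 k -> M (mon3t t).
Proof.
split=> [sM t t_k | tM m [t t_k ->]]; last exact: tM.
by apply: sM; exists t.
Qed.

Lemma clone3_closed k : (k < 7)%N -> subst_closed 'F_3 (clone3 k).
Proof.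
move: k => [|[|[|[|[|[|[|]]]]]]] // _.
- exact: variables_closed.
- exact: one_var_closed.
- exact: all_even_one_var_closed.
- exact: one_odd_closed.
- exact: all_even_one_odd_closed.
- exact: odd_deg_closed.
- exact: monomials_closed.
Qed.

Lemma clone3_min k M : (k < 7)%N -> subst_closed 'F_3 M -> gen_set k `<=` M ->
  clone3 k `<=` M.
Proof.
move=> + M_cl /gen_setP.
move: k => [|[|[|[|[|[|[|]]]]]]] // _ gM.
- exact: variables_min.
- exact: (one_var_min M_cl (gM (2, 0, 0) isT)).
- have M220 : M (mon3 2 2 0) := gM (2, 2, 0) isT.
  rewrite subUset; split; first exact: all_even_min.
  exact: (one_var_min M_cl (square_of_square_square M_cl M220)).
- exact: (one_odd_min M_cl (gM (1, 2, 0) isT)).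
- have M200 : M (mon3 2 0 0) := gM (2, 0, 0) isT.
  have M120 : M (mon3 1 2 0) := gM (1, 2, 0) isT.
  rewrite subUset; split; last exact: one_odd_min.
  exact: (all_even_min M_cl (square_square_of_var_square M_cl M200 M120)).
- exact: (odd_deg_min M_cl (gM (1, 1, 1) isT)).
- exact: (monomials_min M_cl (gM (1, 1, 0) isT)).
Qed.

Lemma subset_or (A B : set {cmonom nat}) :
  A `<=` B \/ exists2 m, A m & ~ B m.
Proof.
have [? | nAB] := pselect (A `<=` B); first by left.
right; apply: contrapT => no_m; apply: nAB => m Am.
by apply: contrapT => nBm; apply: no_m; exists m.
Qed.

(** Each failure of an inclusion of M in one of the sets exhibits a member
    of M that contracts to a generator of another one, and each inclusion
    excludes the generators that have not been found. *)
Lemma classification3 M : subst_closed 'F_3 M ->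
  exists2 k, (k < 7)%N & gen_set k `<=` M /\ M `<=` clone3 k.
Proof.
move=> M_cl.
suff [k [lt_k gM Mk]] : exists k, [/\ (k < 7)%N,
    all (fun t => `[< M (mon3t t) >]) (nth [::] generators3 k)
    & M `<=` clone3 k].
  exists k => //; split=> //; apply/gen_setP=> t t_k.
  by have /allP/(_ t t_k)/asboolP := gM.
have M_mon := closed_monomial M_cl.
have M100 : M (mon3 1 0 0).
  apply: closed_same3 (closed_var M_cl 0) _ => // j; rewrite cmU mon3E.
  by case: j => [|[|[|j]]]; rewrite /= ?nth_nil.
have [M4 | [m Mm m_n4]] := subset_or M (all_even `|` one_odd); last first.
  (* A member outside both sets has at least two odd exponents. *)
  have [i m_i] : exists i, odd (m i).
    apply: contrapT => /forallNP m_even; apply: m_n4; left; split=> [|j].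
      exact: M_mon.
    exact/negP.
  have [j neq_ij m_j] : exists2 j, i != j & odd (m j).
    apply: (@other_index (fun j => odd (m j))) => // m_one.
    by apply: m_n4; right.
  have [m_odd | m_even] := boolP (odd (mdeg m)); last first.
    exists 6; split=> //; rewrite /= asboolT //.
    exact: (product2_mem M_cl Mm m_i m_even).
  have M111 := product3_mem M_cl Mm neq_ij m_i m_j m_odd.
  have [M5 | [m' Mm' /negP m'_even]] := subset_or M odd_deg.
    by exists 5; split=> //; rewrite /= asboolT.
  have M200 := square_mem M_cl Mm' m'_even.
  exists 6; split=> //; rewrite /= asboolT //.
  exact: (product2_of_product3_square M_cl M111 M200).
have [M3 | [m Mm m_n3]] := subset_or M one_odd.
  have [M1 | [m' Mm' m'_n1]] := subset_or M one_var.
    exists 0; split=> //; first by rewrite /= asboolT.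
    by move=> m Mm; split; [exact: M1 | exact: M3].
  exists 3; split=> //; rewrite /= asboolT //.
  exact: (var_square_mem M_cl Mm' (M3 _ Mm') m'_n1).
have m_even : all_even m by case: (M4 m Mm).
have M200 := square_mem M_cl Mm (all_even_deg m_even).
have [M1 | [m1 Mm1 m1_n1]] := subset_or M one_var.
  by exists 1; split=> //; rewrite /= asboolT.
have [M2 | [m2 Mm2 m2_n2]] := subset_or M (all_even `|` one_var).
  have m1_even : all_even m1 by case: (M2 m1 Mm1).
  exists 2; split=> //; rewrite /= asboolT //.
  exact: (square_square_mem M_cl Mm1 m1_even m1_n1).
have m2_one : one_odd m2 by case: (M4 m2 Mm2) => // m2_even; case: m2_n2; left.
exists 4; split=> //; rewrite /= !asboolT //.
by apply: (var_square_mem M_cl Mm2) => // m2_1; apply: m2_n2; right.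
Qed.

Lemma clone3P C :
  monomial_clone 'F_3 C <-> exists2 k, (k < 7)%N & C = clone3 k.
Proof.
rewrite monomial_cloneP.
split=> [C_cl | [k lt_k ->]]; last exact: clone3_closed.
have [k lt_k [gC Ck]] := classification3 C_cl; exists k => //.
by apply/seteqP; split=> //; exact: clone3_min.
Qed.

(** * The inclusion order *)

Definition incl3 j k := all (in_clone3 k) (nth [::] generators3 j).

Lemma incl3P j k : (j < 7)%N -> (k < 7)%N ->
  reflect (clone3 j `<=` clone3 k) (incl3 j k).
Proof.
move=> lt_j lt_k; have gen_j : all (in_clone3 j) (nth [::] generators3 j).
  by move: j lt_j => [|[|[|[|[|[|[|]]]]]]].
apply: (iffP allP) => [sub_jk | sub_jk t t_j].
  apply: clone3_min => //; first exact: clone3_closed.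
  by apply/gen_setP=> t /sub_jk t_k; apply/in_clone3P.
apply/in_clone3P=> //; apply: sub_jk; apply/in_clone3P=> //.
exact: (allP gen_j).
Qed.

Lemma generated3E k (A : set {cmonom nat}) : (k < 7)%N -> A = gen_set k ->
  generated 'F_3 A = clone3 k.
Proof.
move=> lt_k ->; apply: generatedE => [|m|M]; first exact: clone3_closed.
  move: m; apply/gen_setP=> t t_k; apply/in_clone3P=> //.
  by move: t_k; apply/allP: t; move: k lt_k => [|[|[|[|[|[|[|]]]]]]].
exact: clone3_min.
Qed.

Lemma generated_mon3 k t : (k < 7)%N -> nth [::] generators3 k = [:: t] ->
  generated 'F_3 [set mon3t t] = clone3 k.
Proof.
move=> lt_k gen_k; apply: generated3E => //; rewrite /gen_set gen_k.
apply/seteqP; split=> m /= => [-> | [_ /[1!inE]/eqP-> ->]] //.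
by exists t; rewrite ?inE.
Qed.

Lemma proper3P j k : (j < 7)%N -> (k < 7)%N ->
  (clone3 j `<` clone3 k) <-> incl3 j k && ~~ incl3 k j.
Proof.
move=> lt_j lt_k; split=> [[/incl3P jk nkj] | /andP[/incl3P jk /incl3P nkj]].
  by rewrite jk //; apply/negP=> /incl3P kj; apply: nkj; exact: kj.
by split; [exact: jk | exact: nkj].
Qed.

Lemma clone3_uniq : uniq clones3.
Proof.
have -> : clones3 = [seq clone3 k | k <- iota 0 7] by [].
rewrite map_inj_in_uniq ?iota_uniq // => j k.
rewrite !mem_iota /= => lt_j lt_k eq_jk.
have jk : incl3 j k by apply/incl3P=> //; rewrite eq_jk.
have kj : incl3 k j by apply/incl3P=> //; rewrite eq_jk.
move: j k lt_j lt_k jk kj {eq_jk}.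
by move=> [|[|[|[|[|[|[|?]]]]]]] [|[|[|[|[|[|[|?]]]]]]].
Qed.

(** Covering pairs, as positions in clones3. *)
Definition hasse3 : seq (nat * nat) :=
  [:: (0, 3); (3, 5); (5, 6); (0, 1); (1, 2); (2, 4); (3, 4); (4, 6)].

Definition cover3 j k : bool :=
  let lt i l := incl3 i l && ~~ incl3 l i in
  lt j k && ~~ has (fun l => lt j l && lt l k) (iota 0 7).

Lemma cover3E j k : (j < 7)%N -> (k < 7)%N -> cover3 j k = ((j, k) \in hasse3).
Proof.
by move: j k => [|[|[|[|[|[|[|?]]]]]]] [|[|[|[|[|[|[|?]]]]]]].
Qed.

Lemma covered_clone3P j k : (j < 7)%N -> (k < 7)%N ->
  covered_by 'F_3 (clone3 j) (clone3 k) <-> (j, k) \in hasse3.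
Proof.
move=> lt_j lt_k; rewrite -cover3E //.
split=> [[_ _ /proper3P jk no_l] | /andP[jk /hasPn no_l]].
  apply/andP; split; first exact: jk.
  apply/hasPn=> l; rewrite mem_iota => lt_l; apply/negP=> /andP[jl lk].
  apply: (no_l (clone3 l)); first by apply/clone3P; exists l.
  by split; exact/proper3P.
split; [by apply/clone3P; exists j | by apply/clone3P; exists k
  | exact/proper3P |].
move=> _ /clone3P[l lt_l ->] [/proper3P jl /proper3P lk].
have := no_l l; rewrite mem_iota => /(_ lt_l).
by rewrite jl ?lk.
Qed.

(** * Clones over F_2 and conclusion *)

Lemma F2_one_var_min M : subst_closed 'F_2 M -> one_var `<=` M.
Proof.
move=> M_cl m [i m_i]; apply: (closed_same M_cl) (closed_var M_cl i) _.
by apply/same_powers_F2=> j; rewrite m_i cmU eq_sym; case: eqP.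
Qed.

Lemma F2_product_mem M m : subst_closed 'F_2 M -> M m -> ~ one_var m ->
  M (mon3 1 1 0).
Proof.
move=> M_cl Mm m_nvar; have /monomialP[i m_i] := closed_monomial M_cl Mm.
have [j neq_ij m_j] := other_index m_nvar m_i.
have le_m := leq_mdeg2 m neq_ij.
apply: (closed_same M_cl) (contract2 M_cl i Mm) _; apply/same_powers_F2=> l.
have m_lt : (m i < mdeg m)%N.
  by rewrite (leq_trans _ le_m) // -addn1 leq_add2l.
rewrite !mon3E; case: l => [|[|[|l]]]; rewrite /= ?nth_nil //.
by rewrite subn_gt0 m_lt.
Qed.

Theorem proposition3p1 :
  (let C_x1   := generated 'F_2 [set x1] in
   let C_x1x2 := generated 'F_2 [set x1 * x2] in
   (forall C : set {cmonom nat},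
      monomial_clone 'F_2 C <-> C \in [:: C_x1; C_x1x2]) /\
   C_x1 `<` C_x1x2)
  /\
  (let C_x1        := generated 'F_3 [set x1] in
   let C_sq        := generated 'F_3 [set x1 ^+ 2] in
   let C_sqsq      := generated 'F_3 [set x1 ^+ 2 * x2 ^+ 2] in
   let C_x1sq      := generated 'F_3 [set x1 * x2 ^+ 2] in
   let C_sq_x1sq   := generated 'F_3 [set x1 ^+ 2; x1 * x2 ^+ 2] in
   let C_x1x2x3    := generated 'F_3 [set x1 * x2 * x3] in
   let C_x1x2      := generated 'F_3 [set x1 * x2] in
   let clones :=
     [:: C_x1; C_sq; C_sqsq; C_x1sq; C_sq_x1sq; C_x1x2x3; C_x1x2] in
   [/\ forall C : set {cmonom nat}, monomial_clone 'F_3 C <-> C \in clones,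
       uniq clones
     & forall C D : set {cmonom nat},
         covered_by 'F_3 C D <->
         (C, D) \in [:: (C_x1, C_x1sq);
                        (C_x1sq, C_x1x2x3);
                        (C_x1x2x3, C_x1x2);
                        (C_x1, C_sq);
                        (C_sq, C_sqsq);
                        (C_sqsq, C_sq_x1sq);
                        (C_x1sq, C_sq_x1sq);
                        (C_sq_x1sq, C_x1x2)]]).
Proof.
have e1 : x1 = mon3 1 0 0 by rewrite /mon3 !mulm1.
have e2 : x1 ^+ 2 = mon3 2 0 0 by rewrite /mon3 !mulm1.
have e22 : x1 ^+ 2 * x2 ^+ 2 = mon3 2 2 0 by rewrite /mon3 mulm1.
have e12 : x1 * x2 ^+ 2 = mon3 1 2 0 by rewrite /mon3 mulm1.
have e11 : x1 * x2 = mon3 1 1 0 by rewrite /mon3 mulm1.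
split.
  have -> : generated 'F_2 [set x1] = one_var.
    apply: generatedE => [|_ -> | M M_cl _]; first exact: one_var_closed.
      exact: one_var_ucm.
    exact: F2_one_var_min.
  have -> : generated 'F_2 [set x1 * x2] = is_monomial.
    rewrite e11; apply: generatedE => [|_ -> | M M_cl M11].
    - exact: monomials_closed.
    - exact/monomial_mon3.
    - exact: (monomials_min M_cl (M11 _ erefl)).
  split=> [C | ]; last first.
    split=> [|sub]; first exact: one_var_monomial.
    by have /one_var_mon3 := sub (mon3 1 1 0) (iffRL (monomial_mon3 1 1 0) isT).
  rewrite monomial_cloneP !inE; split=> [C_cl | /orP[/eqP-> | /eqP->]].
  - have [C_var | [m Cm m_nvar]] := subset_or C one_var.
      by apply/orP; left; apply/eqP/seteqP; split=> //; exact: F2_one_var_min.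
    apply/orP; right; apply/eqP/seteqP.
    split; first exact: closed_monomial C_cl.
    exact: (monomials_min C_cl (F2_product_mem C_cl Cm m_nvar)).
  - exact: one_var_closed.
  - exact: monomials_closed.
have e111 : x1 * x2 * x3 = mon3 1 1 1 by [].
rewrite e22 e12 e2 e111 e11 e1.
rewrite (@generated_mon3 0 (1, 0, 0)) // (@generated_mon3 1 (2, 0, 0)) //.
rewrite (@generated_mon3 2 (2, 2, 0)) // (@generated_mon3 3 (1, 2, 0)) //.
rewrite (@generated_mon3 5 (1, 1, 1)) // (@generated_mon3 6 (1, 1, 0)) //.
rewrite (@generated3E 4) //; last first.
  apply/seteqP; split=> m; first by case=> ->;
    [exists (2, 0, 0) | exists (1, 2, 0)].
  by case=> t /[!inE] /orP[] /eqP-> ->; [left | right].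
rewrite -/clones3; split; [| exact: clone3_uniq |].
  move=> C; rewrite clone3P; split=> [[k lt_k ->] | /(nthP set0)[k lt_k <-]].
    exact: mem_nth.
  by exists k.
move=> C D.
rewrite -[X in _ \in X]/([seq (clone3 p.1, clone3 p.2) | p <- hasse3]).
split=> [CD | /mapP[[j k] jk [-> ->]]].
  have [/clone3P[j lt_j eC] /clone3P[k lt_k eD] _ _] := CD.
  rewrite eC eD in CD *; apply/mapP; exists (j, k) => //.
  exact/covered_clone3P.
have /andP[lt_j lt_k] : (j < 7) && (k < 7).
  exact: (@allP _ (fun p => (p.1 < 7) && (p.2 < 7)) hasse3 isT _ jk).
exact/covered_clone3P.
Qed.
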